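(* Let $G$ be a simple graph with $V(G)=\{1,\dots,n\}$ that does not have two edge-disjoint cycles of odd length connected by a path, and assume $G$ is not bipartite. Let $s_i$ ($i=1,\dots,n$) and $a_e\le b_e$ ($e\in E(G)$) be integers. Then there exist integers $a_e\le x_e\le b_e$ ($e\in E(G)$) such that $\sum_{i=1}^n s_if_i=\sum_{e\in E(G)}x_ev(e)$ if and only if $\sum_{i=1}^n s_i$ is even and for all disjoint sets $I,J\subset\{1,\dots,n\}$ such that the subgraph of $G$ with vertex set $I\cup J$ and edge set $\{ij\in E(G):i\in I,j\in J\}$ is connected and no connected component of $G-(I\cup J)$ is bipartite, we have $$\sum_{i\in I}s_i-\sum_{j\in J}s_j\le\sum_{e=ij,\ i\in I,\ j\notin I\cup J}b_e+2\sum_{e=ij,\ i,j\in I}b_e-\sum_{e=ij,\ i\notin I\cup J,\ j\in J}a_e-2\sum_{e=ij,\ i,j\in J}a_e.$$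
   Context: $f_1,\dots,f_n$ is the standard basis of $\mathbb{Z}^n$ and for an edge $e=ij$, $v(e)=f_i+f_j$.
   Formalization: G is additionally assumed connected; without this the equivalence fails for every disconnected non-bipartite G, e.g. a triangle plus an isolated vertex with all a_e=b_e=0 and s=2 at one triangle vertex. *)

(* Defs.v *)
From HB Require Import structures.
From mathcomp Require Import all_boot all_order all_algebra.

Set Implicit Arguments.
Unset Strict Implicit.
Unset Printing Implicit Defensive.

Import Order.TTheory GRing.Theory Num.Theory.

(* A graph is given by a vertex set W : {set T} and an edge set
   F : {set {set T}} whose members are two-element subsets of W; thus G itself
   is ([set: T], E), and subgraphs of G are obtained by shrinking W and E. *)
Section Graphs.
Variable T : finType.
Implicit Types (W I J : {set T}) (E F : {set {set T}}).

Definition simple_graph E : Prop := {in E, forall e : {set T}, #|e| = 2}.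

Definition adj F : rel T := [rel x y | [set x; y] \in F].

(* The empty graph counts as connected. *)
Definition connected W F : Prop := {in W &, forall x y, connect (adj F) x y}.

Definition component W F (x : T) : {set T} :=
  [set y in W | connect (adj F) x y].

Definition bipartite W F : Prop :=
  exists A B : {set T},
    [/\ A :|: B = W, [disjoint A & B] &
        {in F, forall e : {set T},
           exists u w, [/\ u \in A, w \in B & e = [set u; w]]}].

Definition edges_between E I J : {set {set T}} :=
  [set e in E | [exists i in I, exists j in J, e == [set i; j]]].

Definition induced_edges E W : {set {set T}} := [set e in E | e \subset W].

(* The components of ([set: T], E) - S are the sets C below, for x outside S;
   each one is regarded as an induced subgraph. *)
Definition no_bipartite_component_outside E (S : {set T}) : Prop :=
  forall x : T, x \notin S ->
    let C := component (~: S) (induced_edges E (~: S)) x in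
    ~ bipartite C (induced_edges E C).

Definition cycle_edges (c : seq T) : {set {set T}} :=
  [set [set x; next c x] | x in c].

(* A cycle is the cyclic sequence of its pairwise distinct vertices, so its
   number of edges is size c. *)
Definition odd_cycle E (c : seq T) : Prop :=
  [/\ ucycle (adj E) c, 2 < size c & odd (size c)].

(* The path x :: p may have length 0, i.e. the two cycles may share a vertex. *)
Definition has_linked_odd_cycles E : Prop :=
  exists c1 c2 : seq T,
    [/\ odd_cycle E c1, odd_cycle E c2,
        [disjoint cycle_edges c1 & cycle_edges c2] &
        exists (x : T) (p : seq T),
          [/\ path (adj E) x p, uniq (x :: p), x \in c1 & last x p \in c2]].

End Graphs.

Local Open Scope ring_scope.

Definition basis_vec (n : nat) (i : 'I_n) : 'rV[int]_n := delta_mx 0 i.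

(* For an edge e = [set i; j] with i != j this is f_i + f_j. *)
Definition edge_vec (n : nat) (e : {set 'I_n}) : 'rV[int]_n :=
  \sum_(i in e) basis_vec i.

(* Main.v *)
(* For a sign vector y in {-1,0,1}^V, with I = {y = 1} and J = {y = -1}, the
   inequality says that the slack
     g(y) = sum_e max(a_e (y_u + y_v), b_e (y_u + y_v)) - sum_v s_v y_v,  e = uv,
   is nonnegative.  As g is linear on the cones cut out by the hyperplanes
   y_u + y_v = 0, it suffices to test it on the rays, which are the pairs (I,J)
   of the theorem.  Nonnegativity of g on all sign vectors gives the cut
   condition for a bounded transportation problem on the bipartite double cover
   of G, whose integral solution f yields the half-integral solution
   (f u v + f v u) / 2.  Its non-integral edges form a graph H with even degrees
   and, by the parity of the sum of s, an even number of edges.  Since any two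
   odd cycles share an edge, a nonempty H contains an even cycle, and shifting
   by 1/2 alternately up and down along it removes it from H. *)

Require Import Defs.
From mathcomp Require Import all_boot all_order all_algebra.
From mathcomp Require Import zify ring lra.
Import Order.TTheory GRing.Theory Num.Theory.
Local Open Scope ring_scope.

Set Implicit Arguments.
Unset Strict Implicit.
Unset Printing Implicit Defensive.

(** * A transportation problem with bounds *)

Section Transportation.
Variables S T : finType.
Implicit Types (P : {set S}) (Q : {set T}) (l u f : S -> T -> int).
Variables (r : S -> int) (c : T -> int).

(** If [f] has row sums [r] and column sums [c], then r(P) - c(Q) is the total of [f] over i in P, j
    not in Q minus its total over i not in P, j in Q. Nonnegativity for all [P], [Q] is thus
    Hoffman's cut condition for [l <= f <= u]. *)
Definition cut_slack l u P Q : int :=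
  \sum_i \sum_j (u i j *+ ((i \in P) && (j \notin Q))
                 - l i j *+ ((i \notin P) && (j \in Q)))
  - (\sum_i r i *+ (i \in P) - \sum_j c j *+ (j \in Q)).

(** Submodularity, checked entry by entry. The entry [(i, j)] contributes [u i j - l i j] on the
    right and nothing to the two cuts on the left, whence the extra term. *)
Lemma cut_slack_uncross l u P Q P' Q' (i : S) (j : T) :
    (forall i j, l i j <= u i j) ->
    i \in P -> j \notin Q -> i \notin P' -> j \in Q' ->
  cut_slack l u (P :&: P') (Q :&: Q') + cut_slack l u (P :|: P') (Q :|: Q')
    + (u i j - l i j) <= cut_slack l u P Q + cut_slack l u P' Q'.
Proof.
move=> le_lu iP jQ iP' jQ'.
have modular (I : finType) (w : I -> int) (A B : {set I}) :
  \sum_i w i *+ (i \in A :&: B) + \sum_i w i *+ (i \in A :|: B) =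
  \sum_i w i *+ (i \in A) + \sum_i w i *+ (i \in B).
  rewrite -!big_split; apply: eq_bigr => k _ /=; rewrite !inE.
  by case: (k \in A); case: (k \in B); rewrite /= ?mulr1n ?mulr0n; lia.
have := modular _ r P P'; have := modular _ c Q Q'.
rewrite /cut_slack.
set X := (X in X - _ + _ + _ <= _).
set Y := (X in _ + (X - _) + _ <= _).
set Z := (X in _ <= X - _ + _).
set W := (X in _ <= _ + (X - _)).
suff: X + Y + (u i j - l i j) <= Z + W by lia.
rewrite /X /Y /Z /W -!big_split /=.
under eq_bigr do rewrite -big_split /=.
under [X in _ <= X]eq_bigr do rewrite -big_split /=.
rewrite (bigD1 i) //= [X in _ <= X](bigD1 i) //= addrAC.
apply: lerD; last first.
  apply: ler_sum => k _; apply: ler_sum => m _; rewrite !inE.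
  have := le_lu k m.
  by case: (k \in P); case: (k \in P'); case: (m \in Q); case: (m \in Q');
     rewrite /= ?mulr1n ?mulr0n; lia.
rewrite (bigD1 j) //= [X in _ <= X](bigD1 j) //= addrAC.
apply: lerD; last first.
  apply: ler_sum => m _; rewrite !inE.
  have := le_lu i m.
  by case: (i \in P); case: (i \in P'); case: (m \in Q); case: (m \in Q');
     rewrite /= ?mulr1n ?mulr0n; lia.
by rewrite !inE iP jQ' (negbTE iP') (negbTE jQ) /= ?mulr1n ?mulr0n; lia.
Qed.

Definition upd f i0 j0 d : S -> T -> int :=
  fun i j => f i j + d *+ ((i == i0) && (j == j0)).

Lemma sum_delta (I J : finType) i0 j0 (d : int) (p : I -> J -> bool) :
  \sum_i \sum_j (d *+ ((i == i0) && (j == j0))) *+ p i j = d *+ p i0 j0.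
Proof.
rewrite (bigD1 i0) //= (bigD1 j0) //= !eqxx /= !big1 ?addr0 //.
- by move=> i /negbTE ni; rewrite big1 // => j _; rewrite ni /= mul0rn.
- by move=> j /negbTE nj; rewrite nj mul0rn.
Qed.

Lemma cut_slack_updu l u i0 j0 d P Q :
  cut_slack l (upd u i0 j0 d) P Q =
  cut_slack l u P Q + d *+ ((i0 \in P) && (j0 \notin Q)).
Proof.
rewrite /cut_slack.
rewrite -(sum_delta i0 j0 d (fun i j => (i \in P) && (j \notin Q))).
rewrite addrAC -big_split /=; congr (_ - _); apply: eq_bigr => i _.
rewrite -big_split /=; apply: eq_bigr => j _.
by rewrite /upd mulrnDl addrAC.
Qed.

Lemma cut_slack_updl l u i0 j0 d P Q :
  cut_slack (upd l i0 j0 d) u P Q =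
  cut_slack l u P Q - d *+ ((i0 \notin P) && (j0 \in Q)).
Proof.
rewrite /cut_slack.
rewrite -(sum_delta i0 j0 d (fun i j => (i \notin P) && (j \in Q))).
rewrite addrAC -sumrB; congr (_ - _); apply: eq_bigr => i _.
rewrite -sumrB; apply: eq_bigr => j _.
by rewrite /upd mulrnDl opprD addrA.
Qed.

(** The two indicators in the slack differ by 1_P(i) - 1_Q(j), so with equal bounds the slack
    separates into row excesses and column excesses. *)
Lemma cut_slack_point l P Q :
  cut_slack l l P Q = \sum_i (\sum_j l i j - r i) *+ (i \in P)
                      - \sum_j (\sum_i l i j - c j) *+ (j \in Q).
Proof.
transitivity (\sum_i (\sum_j l i j) *+ (i \in P)
  - \sum_j (\sum_i l i j) *+ (j \in Q)
  - (\sum_i r i *+ (i \in P) - \sum_j c j *+ (j \in Q))); last first.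
  under [X in _ = X - _]eq_bigr do rewrite mulrnBl.
  under [X in _ = _ - X]eq_bigr do rewrite mulrnBl.
  by rewrite !sumrB; ring.
congr (_ - _); transitivity
    (\sum_i \sum_j (l i j *+ (i \in P) - l i j *+ (j \in Q))).
  apply: eq_bigr => i _; apply: eq_bigr => j _.
  by case: (i \in P); case: (j \in Q); rewrite /= ?mulr1n ?mulr0n; lia.
under eq_bigr do rewrite sumrB.
rewrite sumrB; congr (_ - _); first by apply: eq_bigr => i _; rewrite sumrMnl.
by rewrite exchange_big; apply: eq_bigr => j _ /=; rewrite sumrMnl.
Qed.

(* As long as some interval [l i j, u i j] is not a point, one of its ends can
   be moved inwards: a cut tight against each move would, by uncrossing, give
   a cut of negative slack. *)
Lemma transportation l u :
    (forall i j, l i j <= u i j) -> \sum_i r i = \sum_j c j ->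
    (forall P Q, 0 <= cut_slack l u P Q) ->
  exists f, [/\ forall i j, l i j <= f i j <= u i j,
    forall i, \sum_j f i j = r i & forall j, \sum_i f i j = c j].
Proof.
move=> le_lu eq_rc.
have [k] := ubnP (absz (\sum_i \sum_j (u i j - l i j))).
elim: k l u le_lu => // k IHk l u le_lu lt_k slack.
have [/existsP[i /existsP[j ne_ij]]|/existsPn eq_lu] :=
  boolP [exists i, exists j, l i j != u i j]; last first.
  have {}eq_lu i j : u i j = l i j.
    by have /existsPn/(_ j)/negPn/eqP := eq_lu i.
  have {}slack P Q : 0 <= cut_slack l l P Q.
    have := slack P Q; rewrite /cut_slack.
    by under eq_bigr do under eq_bigr do rewrite eq_lu.
  (* Singleton cuts bound each row sum from below and each column sum from above; since the totals
     agree, none of these inequalities is strict. *)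
  have row i : r i <= \sum_j l i j.
    have := slack [set i] set0; rewrite cut_slack_point.
    rewrite (bigD1 i) //= [X in _ + X - _]big1 => [|i' /negbTE ni].
      by rewrite [X in _ - X]big1 => [|j _]; rewrite !inE ?eqxx //; lia.
    by rewrite inE ni.
  have col j : \sum_i l i j <= c j.
    have := slack set0 [set j]; rewrite cut_slack_point.
    rewrite [X in _ - X](bigD1 j) //= [X in _ - (_ + X)]big1 => [|j' /negbTE nj].
      by rewrite big1 => [|i _]; rewrite !inE ?eqxx //; lia.
    by rewrite inE nj.
  have tot : \sum_j \sum_i l i j = \sum_i \sum_j l i j by apply: exchange_big.
  exists l; split=> [i j|i|j]; first by rewrite eq_lu lexx.
  - apply/eqP; rewrite eq_le row andbT.
    have : \sum_(k | k != i) r k <= \sum_(k | k != i) \sum_j l k j.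
      exact: ler_sum.
    have : \sum_j \sum_i l i j <= \sum_j c j by apply: ler_sum.
    by rewrite tot -eq_rc (bigD1 i) //= [X in _ <= X](bigD1 i) //=; lra.
  - apply/eqP; rewrite eq_le col /=.
    have : \sum_(k | k != j) \sum_i l i k <= \sum_(k | k != j) c k.
      exact: ler_sum.
    have : \sum_i r i <= \sum_i \sum_j l i j by apply: ler_sum.
    by rewrite -tot eq_rc (bigD1 j) //= [X in _ <= X](bigD1 j) //=; lra.
have lt_ij : l i j < u i j by rewrite lt_neqAle ne_ij le_lu.
have gap (l' u' : S -> T -> int) : (forall i j, l' i j <= u' i j) ->
    (forall i' j', u' i' j' - l' i' j' =
       u i' j' - l i' j' - 1 *+ ((i' == i) && (j' == j))) ->
    (absz (\sum_i \sum_j (u' i j - l' i j))%R < k)%N.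
  move=> le' eq'.
  have ge0 : 0 <= \sum_i \sum_j (u' i j - l' i j).
    by do 2!apply: sumr_ge0 => ? _; rewrite subr_ge0.
  have : \sum_i \sum_j (u' i j - l' i j) = \sum_i \sum_j (u i j - l i j) - 1.
    under eq_bigr do under eq_bigr do rewrite eq'.
    under eq_bigr do rewrite sumrB.
    rewrite sumrB; congr (_ - _).
    by rewrite -[RHS](sum_delta i j 1 (fun _ _ => true)).
  by move: lt_k ge0; lia.
have [/forallP tight|/forallPn[P /forallPn[Q]]] :=
  boolP [forall P, forall Q, 0 <= cut_slack l (upd u i j (-1)) P Q].
  have le' i' j' : l i' j' <= upd u i j (-1) i' j'.
    rewrite /upd; have := le_lu i' j'.
    by case: eqP => [->|_]; case: eqP => [->|_]; rewrite /= ?mulr1n ?mulr0n; lia.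
  have [||f [box rows cols]] := IHk l (upd u i j (-1)) le' _ _.
  - by apply: gap => // i' j'; rewrite /upd mulNrn; lia.
  - by move=> P Q; have /forallP := tight P.
  exists f; split=> // i' j'; have /andP[-> /= le_f] := box i' j'.
  apply: le_trans le_f _; rewrite /upd gerDl mulNrn oppr_le0.
  by case: (_ && _).
have := slack P Q; rewrite cut_slack_updu.
have [/andP[iP jQ] ge0 neg|] := boolP (_ && _); last by rewrite mulr0n; lia.
have le' i' j' : upd l i j 1 i' j' <= u i' j'.
  rewrite /upd; have := le_lu i' j'.
  by case: eqP => [->|_]; case: eqP => [->|_]; rewrite /= ?mulr1n ?mulr0n; lia.
have [||f [box rows cols]] := IHk (upd l i j 1) u le' _ _.
- by apply: gap => // i' j'; rewrite /upd; lia.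
- move=> P' Q'; rewrite cut_slack_updl.
  have [/andP[iP' jQ']|] := boolP (_ && _); last by rewrite mulr0n subr0.
  (* Lowering [u i j] by 1 made [(P, Q)] negative, so its slack is 0. Uncrossing then gives
     [(P', Q')] slack at least [u i j - l i j >= 1], which pays for raising [l i j]. *)
  have := cut_slack_uncross le_lu iP jQ iP' jQ'.
  have := slack (P :&: P') (Q :&: Q'); have := slack (P :|: P') (Q :|: Q').
  by move: ge0 neg; rewrite /= !mulr1n; lia.
exists f; split=> // i' j'; have /andP[le_f ->] := box i' j'; rewrite andbT.
by apply: le_trans le_f; rewrite /upd lerDl; case: (_ && _).
Qed.
End Transportation.

(** * Cycles and rounding *)

Section Cycles.
Variable T : finType.
Implicit Types (E F : {set {set T}}) (c : seq T) (e : {set T}) (u v x y z : T).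

Lemma adj_sym F : symmetric (adj F).
Proof. by move=> x y; rewrite /adj /= setUC. Qed.

Lemma simple_edgeP E e :
  simple_graph E -> e \in E -> exists u v, u != v /\ e = [set u; v].
Proof.
by move=> sE /sE/eqP/cards2P[u [v [nuv ->]]]; exists u, v.
Qed.

Lemma simple_adj_neq E x y : simple_graph E -> adj E x y -> x != y.
Proof.
move=> sE; apply: contraTneq => ->; rewrite /adj /= setUid.
by apply/negP => /sE; rewrite cards1.
Qed.

Lemma simple_graphS E F : F \subset E -> simple_graph E -> simple_graph F.
Proof. by move=> /subsetP sFE sE e /sFE/sE. Qed.

Lemma big_set_in (R : nmodType) (I : finType) (A : {set I}) (P : pred I) (w : I -> R) :
  \sum_(i in [set i in A | P i]) w i = \sum_(i in A | P i) w i.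
Proof. by apply: eq_bigl => i; rewrite inE. Qed.

Lemma sum_set2 (w : T -> int) u v :
  u != v -> \sum_(x in [set u; v]) w x = w u + w v.
Proof. by move=> nuv; rewrite big_setU1 ?inE // big_set1. Qed.

(** The first vertex of a longest path has a neighbour besides its successor; by maximality this
    neighbour lies on the path and closes a cycle. *)
Lemma exists_cycle F :
    simple_graph F -> F != set0 ->
    (forall x y, adj F x y -> exists2 z, adj F x z & z != y) ->
  exists c, ucycle (adj F) c /\ (2 < size c)%N.
Proof.
move=> sF /set0Pn[e0 e0F] deg2.
pose P k := [exists c : k.-tuple T, uniq c && sorted (adj F) c].
have exP : exists k, P k.
  by exists 0%N; apply/existsP; exists [tuple].
have ubP k : P k -> (k <= #|T|)%N.
  by case/existsP=> c /andP[/card_uniqP uc _]; rewrite -(size_tuple c) -uc max_card.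
case: (ex_maxnP exP ubP) => k /existsP[[c /= /eqP sz_c] /andP[/= uc pc]] max_k.
have max_c c' : uniq c' -> sorted (adj F) c' -> (size c' <= size c)%N.
  move=> uc' pc'; rewrite sz_c; apply: max_k.
  by apply/existsP; exists (in_tuple c'); rewrite uc'.
have [u [v [nuv e0E]]] := simple_edgeP sF e0F.
have : (2 <= size c)%N.
  by apply: (max_c [:: u; v]); rewrite /= ?inE ?nuv /adj //= -e0E e0F.
case: c uc pc max_c {sz_c} => [|x [|y r]] //= /and3P[xNr yNr ur] /andP[xy pr] max_c _.
have [z xz nzy] := deg2 _ _ xy.
have nxz := simple_adj_neq sF xz.
have zr : z \in r.
  apply/negPn/negP => zNr.
  suff : ((size r).+3 <= (size r).+2)%N by rewrite ltnn.
  apply: (max_c [:: z, x, y & r]).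
    by rewrite /= xNr yNr ur !inE eq_sym (negbTE nxz) (negbTE nzy) (negbTE zNr).
  by rewrite /= (adj_sym F z x) xz xy.
case/splitPr: zr xNr yNr ur pr {max_c} => r1 r2 xNr yNr ur pr.
exists [:: x, y & rcons r1 z]; split; last by rewrite /= size_rcons.
apply/andP; split.
  rewrite /= rcons_path last_rcons (adj_sym F z x) xz andbT xy /=.
  by move: pr; rewrite -cat_rcons cat_path => /andP[].
move: xNr yNr ur; rewrite -cat_rcons !inE !mem_cat cat_uniq /= !negb_or.
by case/and3P=> -> -> _ /andP[-> _] /andP[-> _].
Qed.

Lemma mem_cycle_edges c x : x \in c -> [set x; next c x] \in cycle_edges c.
Proof. exact: imset_f. Qed.

Lemma cycle_edges_sub F c : cycle (adj F) c -> cycle_edges c \subset F.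
Proof. by move=> cc; apply/subsetP=> _ /imsetP[x xc ->]; apply: (next_cycle cc xc). Qed.

Lemma next_next_neq c x :
  uniq c -> (2 < size c)%N -> x \in c -> next c x != x /\ next c (next c x) != x.
Proof.
move=> uc sz xc; have [i c' Ec] := rot_to xc.
rewrite -!(next_rot i uc) Ec.
move: sz uc; rewrite -(size_rot i) -(rot_uniq i) Ec.
case: c' {Ec} => [|y [|z r]] //= _; rewrite !inE !negb_or.
case/and3P=> /and3P[nxy nxz _] _ _.
by rewrite !eqxx !(eq_sym y) (negbTE nxy) eq_sym.
Qed.

(** Distinct vertices with the same outgoing edge would be each other's successors. *)
Lemma cycle_edge_inj c : uniq c -> (2 < size c)%N ->
  {in c &, injective (fun x => [set x; next c x])}.
Proof.
move=> uc sz x y xc yc /= /setP eq_xy; apply/eqP/negPn/negP => nxy.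
have := eq_xy x; have := eq_xy y; rewrite !inE !eqxx (eq_sym y) (negbTE nxy) /=.
move=> /eqP nx /esym/eqP ny.
by have [_] := next_next_neq uc sz xc; rewrite -nx -ny eqxx.
Qed.

Lemma cycle_star c v : uniq c -> (2 < size c)%N -> v \in c ->
  [set e in cycle_edges c | v \in e] =
    [set [set v; next c v]; [set prev c v; next c (prev c v)]]
  /\ [set v; next c v] != [set prev c v; next c (prev c v)].
Proof.
move=> uc sz vc; have pc : prev c v \in c by rewrite mem_prev.
split; last first.
  apply/eqP => /(cycle_edge_inj uc sz vc pc) ev.
  have [] := next_next_neq uc sz vc; by rewrite {1}ev next_prev // eqxx.
apply/setP => e; rewrite !inE; apply/andP/orP => [[/imsetP[x xc ->]]|].
  rewrite !inE => /orP[]/eqP ->; [by left | right].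
  by rewrite prev_next.
case=> /eqP ->; rewrite mem_cycle_edges //; first by rewrite !inE eqxx.
by rewrite next_prev // !inE eqxx orbT.
Qed.

Lemma cycle_star0 c v : v \notin c -> [set e in cycle_edges c | v \in e] = set0.
Proof.
move=> vNc; apply/setP => e; rewrite !inE; apply/negP => /andP[/imsetP[x xc ->]].
by rewrite !inE => /orP[]/eqP vE; move: vNc; rewrite vE ?mem_next xc.
Qed.

Lemma card_cycle_edges c :
  uniq c -> (2 < size c)%N -> #|cycle_edges c| = size c.
Proof.
by move=> uc sz; rewrite (card_in_imset (cycle_edge_inj uc sz)); apply/card_uniqP.
Qed.

Lemma odd_index_next c x : uniq c -> ~~ odd (size c) -> x \in c ->
  odd (index (next c x) c) = ~~ odd (index x c).
Proof.
move=> uc ev xc; rewrite next_nth xc.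
case: c uc ev xc => [|y p] // uc ev xc.
have : (index x (y :: p) <= size p)%N by rewrite -ltnS; move: xc; rewrite -index_mem.
rewrite leq_eqVlt => /orP[/eqP Ei|lt].
  (* Wrap-around: the last index [size p] is odd because the length is even, and the successor is
     the head, at index 0. *)
  by rewrite Ei nth_default //= eqxx; move: ev => /=; rewrite negbK => ->.
by rewrite -[nth y p _]/(nth y (y :: p) (index x (y :: p)).+1) index_uniq.
Qed.

Lemma alternating_cycle c : uniq c -> (2 < size c)%N -> ~~ odd (size c) ->
  exists d : {set T} -> int,
    (forall e, e \in cycle_edges c -> d e = 1 \/ d e = -1) /\
    (forall v, \sum_(e in cycle_edges c | v \in e) d e = 0).
Proof.
move=> uc sz ev.
(* A cycle edge is the outgoing edge of exactly one vertex, so on it this sum has a single term, the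
   sign given by the parity of that vertex's index. *)
pose d e : int :=
  \sum_(x in c | [set x; next c x] == e) (-1) ^+ odd (index x c).
have dE x : x \in c -> d [set x; next c x] = (-1) ^+ odd (index x c).
  move=> xc; rewrite /d (big_pred1 x) // => y.
  apply/andP/eqP => [[yc /eqP]|->]; last by rewrite eqxx.
  exact: (cycle_edge_inj uc sz).
exists d; split=> [_ /imsetP[x xc ->]|v].
  by rewrite dE //; case: (odd _); [right | left].
rewrite -big_set_in.
have [vc|vNc] := boolP (v \in c); last by rewrite cycle_star0 // big_set0.
have [-> nvp] := cycle_star uc sz vc.
have pc : prev c v \in c by rewrite mem_prev.
rewrite big_setU1 ?inE // big_set1 !dE // -{1}(next_prev uc v) odd_index_next //.
by case: (odd _).
Qed.

(** * Even cycles in graphs with even degrees, and rounding *)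

Definition even_degrees F := forall v, ~~ odd #|[set e in F | v \in e]|.

Lemma even_degrees_cycle F : simple_graph F -> even_degrees F -> F != set0 ->
  exists c, ucycle (adj F) c /\ (2 < size c)%N.
Proof.
move=> sF evF nF; apply: exists_cycle => // x y xy.
pose St := [set e in F | x \in e].
have xySt : [set x; y] \in St by rewrite !inE eqxx andbT.
have : (0 < #|St :\ [set x; y]|)%N.
  by have := evF x; rewrite -/St (cardsD1 [set x; y]) xySt; case: #|_|.
case/card_gt0P => e; rewrite !inE => /and3P[ne eF xe].
have [u [v [nuv eE]]] := simple_edgeP sF eF.
move: xe eF ne; rewrite eE !inE => /orP[]/eqP <- eF ne.
  by exists v => //; apply: contraNneq ne => ->.
exists u; first by rewrite /adj /= setUC.
by apply: contraNneq ne => ->; rewrite setUC.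
Qed.

(** A cycle has two edges at each of its vertices and none elsewhere. *)
Lemma even_degreesD F c : even_degrees F -> ucycle (adj F) c -> (2 < size c)%N ->
  even_degrees (F :\: cycle_edges c).
Proof.
move=> evF /andP[cc uc] sz v.
have /subsetP sub := cycle_edges_sub cc.
have -> : [set e in F :\: cycle_edges c | v \in e] =
    [set e in F | v \in e] :\: [set e in cycle_edges c | v \in e].
  by apply/setP => e; rewrite !inE; case: (v \in e); rewrite ?andbT ?andbF.
rewrite cardsDS; last by apply/subsetP => e; rewrite !inE => /andP[/sub -> ->].
have : ([set e in cycle_edges c | v \in e] \subset [set e in F | v \in e]).
  by apply/subsetP => e; rewrite !inE => /andP[/sub -> ->].
move=> /subset_leq_card le; rewrite oddB // (negbTE (evF v)) /=.
have [vc|vNc] := boolP (v \in c); last by rewrite cycle_star0 // cards0.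
by have [-> nvp] := cycle_star uc sz vc; rewrite cards2 nvp.
Qed.

Lemma odd_cycleS E F c : F \subset E -> odd_cycle F c -> odd_cycle E c.
Proof.
move=> /subsetP sFE [/andP[cc uc] sz od]; split=> //.
by apply/andP; split=> //; apply: sub_cycle cc => x y /= /sFE.
Qed.

(** If a first cycle is odd, removing its edges leaves a graph that is nonempty, as [#|F|] is even,
    and still has even degrees. A second cycle found there is edge-disjoint from the first, so it
    cannot be odd. *)
Lemma even_cycle F : simple_graph F ->
    (forall c1 c2, odd_cycle F c1 -> odd_cycle F c2 ->
       ~~ [disjoint cycle_edges c1 & cycle_edges c2]) ->
    even_degrees F -> F != set0 -> ~~ odd #|F| ->
  exists c, [/\ ucycle (adj F) c, (2 < size c)%N & ~~ odd (size c)].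
Proof.
move=> sF meet evF nF oddF.
have [c [ucc sz]] := even_degrees_cycle sF evF nF.
have [odc|] := boolP (odd (size c)); last by exists c.
have /andP[cc uc] := ucc.
have subF := subsetDl F (cycle_edges c).
have [|c' [ucc' sz']] :=
    even_degrees_cycle (simple_graphS subF sF) (even_degreesD evF ucc sz).
  apply: contraNneq oddF => F0.
  have /eqP : #|F :\: cycle_edges c| = 0%N by rewrite F0 cards0.
  have sub := cycle_edges_sub cc.
  rewrite cardsDS // subn_eq0 => le.
  have -> : #|F| = size c; last by [].
  apply/eqP; rewrite -card_cycle_edges // eqn_leq le; exact: subset_leq_card.
exists c'; have /andP[cc' uc'] := ucc'.
split=> //.
  by apply/andP; split=> //; apply: sub_cycle cc' => x y /=; apply: subsetP.
apply/negP => odc'; have /negP[] := meet c c' (And3 ucc sz odc)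
  (odd_cycleS subF (And3 ucc' sz' odc')).
rewrite disjoint_sym disjoints_subset; apply: subset_trans (cycle_edges_sub cc') _.
by apply/subsetP => e; rewrite !inE => /andP[].
Qed.

Lemma odd_abszD (m n : int) : odd (absz (m + n)) = odd (absz m) (+) odd (absz n).
Proof. lia. Qed.

Lemma odd_absz_sum (I : finType) (A : {set I}) (w : I -> int) :
  odd (absz (\sum_(i in A) w i)) = odd #|[set i in A | odd (absz (w i))]|.
Proof.
rewrite (big_morph (fun m : int => odd (absz m)) odd_abszD (erefl _)).
rewrite -sum1_card (big_morph odd oddD (erefl _)).
rewrite [RHS](eq_bigl (fun i => (i \in A) && odd (absz (w i)))) => [|i].
  by rewrite [RHS]big_mkcondr; apply: eq_bigr => i _; case: (odd _).
by rewrite inE.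
Qed.

Lemma sum_degrees E (x : {set T} -> int) : simple_graph E ->
  \sum_v \sum_(e in E | v \in e) x e = 2 * \sum_(e in E) x e.
Proof.
move=> sE; rewrite (exchange_big_dep (mem E)) /= => [|v e _ /andP[]//].
rewrite mulr_sumr; apply: eq_bigr => e eE.
rewrite (eq_bigl (mem e)) => [|v]; last by rewrite eE.
by rewrite sumr_const (sE _ eE) mulr_natl.
Qed.

(* Shifting alternately by +1 and -1 around an even cycle of odd values
   preserves the degrees and makes these values even. *)
Lemma halving E (x a b : {set T} -> int) (s : T -> int) : simple_graph E ->
    (forall c1 c2, odd_cycle E c1 -> odd_cycle E c2 ->
       ~~ [disjoint cycle_edges c1 & cycle_edges c2]) ->
    ~~ odd (absz (\sum_v s v)) ->
    {in E, forall e, 2 * a e <= x e <= 2 * b e} ->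
    (forall v, \sum_(e in E | v \in e) x e = 2 * s v) ->
  exists x' : {set T} -> int, {in E, forall e, a e <= x' e <= b e} /\
    forall v, \sum_(e in E | v \in e) x' e = s v.
Proof.
move=> sE meet ev_s.
have [k] := ubnP #|[set e in E | odd (absz (x e))]|.
elim: k x => // k IHk x; set H := [set e in E | _] => lt_k box deg.
have HE : H \subset E by apply/subsetP => e; rewrite inE => /andP[].
have [H0|nH] := eqVneq H set0.
  have even e : e \in E -> x e = 2 * (x e %/ 2)%Z.
    move=> eE; have : e \notin H by rewrite H0 inE.
    rewrite inE eE /=; lia.
  exists (fun e => (x e %/ 2)%Z); split=> [e eE|v].
    by have := box e eE; rewrite (even e eE); lia.
  apply: (@mulfI _ 2) => //; rewrite -deg mulr_sumr.
  by apply: eq_bigr => e /andP[/even <-].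
(* By the handshake identity; the even total then makes [#|H|] even. *)
have sumE : \sum_(e in E) x e = \sum_v s v.
  apply: (@mulfI _ 2) => //; rewrite -sum_degrees // mulr_sumr.
  by apply: eq_bigr => v _; apply: deg.
(* Modulo 2 the sum at [v], which is [2 * s v], counts the edges of [H] at [v]. *)
have evH : even_degrees H.
  move=> v; have := deg v; rewrite -big_set_in.
  move/(congr1 (fun m : int => odd (absz m))).
  rewrite odd_absz_sum (_ : [set _ in _ | _] = [set e in H | v \in e]).
    by move=> ->; rewrite abszM oddM.
  by apply/setP => e; rewrite !inE andbAC.
have oddH : ~~ odd #|H| by rewrite -odd_absz_sum sumE.
have [c1 c2 oc1 oc2|c [/andP[cc uc] sz evc]] :=
    even_cycle (simple_graphS HE sE) _ evH nH oddH.
  by apply: meet; apply: odd_cycleS HE _.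
have [d [d1 d0]] := alternating_cycle uc sz evc.
have /subsetP CH := cycle_edges_sub cc.
pose C := cycle_edges c.
pose x1 e := x e + (if e \in C then d e else 0).
have x1C e : e \in C -> odd (absz (x e)) /\ (x1 e = x e + 1 \/ x1 e = x e - 1).
  move=> eC; split; first by have := CH e eC; rewrite inE => /andP[].
  by rewrite /x1 eC; have [->|->] := d1 e eC; [left | right].
apply: (IHk x1) => [|e eE|v].
(* Parities off the cycle are unchanged and values on it become even, so the set of odd edges
   shrinks properly. *)
- rewrite -ltnS; apply: leq_trans lt_k; rewrite ltnS; apply: proper_card.
  have [z zc] : exists z, z \in c.
    by case: (c) sz => // z c' _; exists z; rewrite inE eqxx.
  have eC := mem_cycle_edges zc.
  apply/properP; split.
    apply/subsetP => e; rewrite !inE => /andP[eE]; rewrite eE /x1.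
    have [/CH|_] := boolP (e \in C); last by rewrite addr0.
    by rewrite inE eE => ->.
  exists [set z; next c z]; first exact: CH.
  by rewrite inE; have [] := x1C _ eC; move=> o [->|->]; lia.
(* An odd value differs from the even bounds [2 * a e] and [2 * b e], so a shift by 1 stays between
   them. *)
- have := box e eE; have [eC|eC] := boolP (e \in C).
    by have [o [->|->]] := x1C _ eC; lia.
  by rewrite /x1 (negbTE eC) addr0.
rewrite -deg big_split /= -[RHS]addr0; congr (_ + _).
rewrite -[RHS](d0 v) -big_mkcondr; apply: eq_bigl => e /=.
rewrite -/C; have [eC|_] := boolP (e \in C); last by rewrite andbF.
by have := CH e eC; rewrite inE andbT => /andP[-> _].
Qed.

End Cycles.

(** * Reduction to connected pairs *)

(** For [a <= b] this is the support function of the interval [a, b], linear on each side of 0. *)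
Definition upper_slope (a b t : int) : int := if 0 <= t then b * t else a * t.

Lemma upper_slope0 a b : upper_slope a b 0 = 0.
Proof. by rewrite /upper_slope lexx mulr0. Qed.

Lemma upper_slopeD a b (t t' : int) : 0 <= t * t' ->
  upper_slope a b (t + t') = upper_slope a b t + upper_slope a b t'.
Proof.
move=> same.
have [->|nt] := eqVneq t 0; first by rewrite upper_slope0 !add0r.
have [->|nt'] := eqVneq t' 0; first by rewrite upper_slope0 !addr0.
rewrite /upper_slope.
have : 0 < t /\ 0 < t' \/ t < 0 /\ t' < 0 by nia.
case=> [[pt pt']|[pt pt']].
  by rewrite !ltW ?addr_gt0 // mulrDr.
by rewrite !leNgt pt pt' (_ : t + t' < 0) ?mulrDr //; lia.
Qed.

Section Slack.
Variables (T : finType) (E : {set {set T}}).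
Variables (s : T -> int) (a b : {set T} -> int).
Hypothesis simpleE : simple_graph E.
Implicit Types (y z : T -> int) (e : {set T}) (u v x : T) (A B K : {set T}).

Definition wt y e : int := \sum_(v in e) y v.

Definition slack y : int :=
  \sum_(e in E) upper_slope (a e) (b e) (wt y e) - \sum_v s v * y v.

(** The edges whose hyperplane y_u + y_v = 0 misses [y]. Passing to a proper face of the cone of [y]
    shrinks this set, so its cardinality serves as the induction measure. *)
Definition loose y : {set {set T}} := [set e in E | wt y e != 0].

Definition signs y : Prop := forall v, -1 <= y v <= 1.

Lemma edge_ind (P : {set T} -> Prop) :
  (forall u v, u != v -> adj E u v -> P [set u; v]) -> {in E, forall e, P e}.
Proof.
move=> IH e eE; have [u [v [nuv eE']]] := simple_edgeP simpleE eE.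
by rewrite eE'; apply: IH => //; rewrite /adj /= -eE'.
Qed.

Lemma wt_set2 y u v : u != v -> wt y [set u; v] = y u + y v.
Proof. exact: sum_set2. Qed.

Lemma wtD y z e : wt (fun v => y v + z v) e = wt y e + wt z e.
Proof. exact: big_split. Qed.

Lemma wtN y e : wt (fun v => - y v) e = - wt y e.
Proof. exact: sumrN. Qed.

(** Weights of compatible sign on every edge put [y] and [z] in one cone of the arrangement, where
    [slack] is linear. *)
Lemma slackD y z : {in E, forall e, 0 <= wt y e * wt z e} ->
  slack (fun v => y v + z v) = slack y + slack z.
Proof.
move=> same; rewrite /slack addrACA -opprD -!big_split /=; congr (_ - _).
  by apply: eq_bigr => e eE; rewrite wtD upper_slopeD ?same.
by apply: eq_bigr => v _; rewrite mulrDr.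
Qed.

Lemma loose_sub y z : {in E, forall e, wt y e = 0 -> wt z e = 0} ->
  loose z \subset loose y.
Proof.
move=> zy; apply/subsetP => e; rewrite !inE => /andP[eE]; rewrite eE /=.
by apply: contra_neq => /zy ->.
Qed.

Lemma loose_proper y z e : {in E, forall e, wt y e = 0 -> wt z e = 0} ->
  e \in loose y -> wt z e = 0 -> (#|loose z| < #|loose y|)%N.
Proof.
move=> zy ey ez; apply/proper_card/properP; split; first exact: loose_sub.
by exists e => //; rewrite inE ez eqxx andbF.
Qed.

Lemma in_loose y e : e \in E -> (e \in loose y) = (wt y e != 0).
Proof. by move=> eE; rewrite inE eE. Qed.

Hypothesis connE : connected [set: T] E.
Hypothesis nbipE : ~ bipartite [set: T] E.

(** Such a [y] changes sign along every edge. By connectedness one nonzero value makes all values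
    nonzero, and the two sign classes would be a bipartition. *)
Lemma wt_eq0 y : {in E, forall e, wt y e = 0} -> forall x, y x = 0.
Proof.
move=> y0 x; apply/eqP/negPn/negP => nx; apply: nbipE.
have opp u v : u != v -> adj E u v -> y v = - y u.
  by move=> nuv /y0; rewrite wt_set2 //; lia.
have nz v : y v != 0.
  have cl : closed (adj E) [pred v | y v != 0].
    move=> u w uw; rewrite !inE (opp u w) ?oppr_eq0 //.
    exact: simple_adj_neq uw.
  by have := closed_connect cl (connE (in_setT x) (in_setT v)); rewrite !inE nx.
exists [set v | 0 < y v], [set v | y v < 0]; split.
- by apply/setP => v; rewrite !inE; have := nz v; lia.
- by rewrite disjoints_subset; apply/subsetP => v; rewrite !inE; lia.
- apply: edge_ind => u v nuv uv; have := opp _ _ nuv uv; have := nz u.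
  have [pu|pu] := ltP 0 (y u) => nu vE.
    by exists u, v; split; rewrite ?inE //; lia.
  by exists v, u; rewrite [[set v; u]]setUC; split; rewrite ?inE //; lia.
Qed.

(** * Minimal sign vectors of negative slack *)

Section Minimal.
Variable k : nat.
(** The induction hypothesis of [slack_ge0]: a sign vector with at most [k] loose edges and negative
    slack is a minimal counterexample. *)
Hypothesis slack_lt : forall y, signs y -> (#|loose y| < k)%N -> 0 <= slack y.

(* By linearity g(y) = g(y - z) + g(z).  If y has the fewest loose edges among
   the sign vectors with g < 0, then g(z) < 0 and z has the same loose edges as
   y, so that y - z vanishes on every edge, which forces y = z. *)
Lemma no_reduction y z x :
    signs z -> signs (fun v => y v + - z v) -> z x != 0 -> y x = 0 ->
    (#|loose y| <= k)%N -> slack y < 0 ->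
  ~ {in E, forall e, wt z e = 0 \/ wt z e = wt y e}.
Proof.
move=> sz syz nzx yx0 le_k neg cases.
have zy : {in E, forall e, wt y e = 0 -> wt z e = 0}.
  by move=> e /cases[->|->].
have yzy : {in E, forall e, wt y e = 0 -> wt (fun v => y v + - z v) e = 0}.
  by move=> e eE; rewrite wtD wtN; case: (cases e eE) => ->; lia.
have add : slack y = slack (fun v => y v + - z v) + slack z.
  rewrite -slackD => [|e eE]; last first.
    by rewrite wtD wtN; case: (cases e eE) => ->; rewrite ?subrr ?mul0r ?mulr0.
  rewrite /slack; congr (_ - _); apply: eq_bigr => i _.
    by congr upper_slope; apply: eq_bigr => v _; rewrite subrK.
  by rewrite subrK.
have [z0|/set0Pn[e]] := eqVneq (loose z) set0.
  move: nzx; rewrite (wt_eq0 (y := z)) ?eqxx // => e eE.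
  by apply/eqP/negPn; rewrite -in_loose // z0 inE.
rewrite inE => /andP[eE nze].
have ey : e \in loose y.
  by rewrite inE eE; move: nze; apply: contra_neq => /zy ->.
have : 0 <= slack (fun v => y v + - z v).
  apply: slack_lt => //; apply: leq_trans le_k.
  apply: loose_proper ey _ => //.
  by rewrite wtD wtN; case: (cases e eE) => we; lia.
move=> ge0; have {}neg : slack z < 0 by lia.
have le_kz : (k <= #|loose z|)%N.
  by rewrite leqNgt; apply/negP => /(slack_lt sz); rewrite leNgt neg.
have eq_l : loose z = loose y.
  by apply/eqP; rewrite eqEcard (loose_sub zy) (leq_trans le_k).
have : y x + - z x = 0.
  apply: (wt_eq0 (y := fun v => y v + - z v)) => f fE; rewrite wtD wtN.
  have := in_loose z fE; rewrite eq_l in_loose //.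
  by case: (cases f fE) => ->; lia.
by move: nzx; rewrite yx0; lia.
Qed.

(* For z = 1_A - 1_B every edge has z-weight 0, equal to its y-weight or opposite
   to it, so g(y + z) + g(y - z) = 2 g(y).  If both of the last two cases occur,
   then y + z and y - z have fewer loose edges than y. *)
Lemma no_bipartite_piece y A B x :
    signs y -> (#|loose y| <= k)%N -> slack y < 0 ->
    [disjoint A & B] -> x \in A :|: B ->
    {in A :|: B, forall v, y v = 0} ->
    (forall u v, adj E u v -> u \in A :|: B -> v \in A :|: B \/ y v != 0) ->
    {in A &, forall u v, ~~ adj E u v} -> {in B &, forall u v, ~~ adj E u v} ->
  False.
Proof.
move=> sy le_k neg dAB xAB y0 clos indA indB.
pose z v : int := (v \in A)%:Z - (v \in B)%:Z.
have NAB v : v \in A -> v \in B = false by apply: disjointFr.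
have zA v : v \in A -> z v = 1 by move=> vA; rewrite /z NAB ?vA.
have zB v : v \in B -> z v = -1.
  by move=> vB; rewrite /z vB (disjointFl dAB).
have zAB v : v \notin A :|: B -> z v = 0.
  by rewrite inE negb_or /z => /andP[/negbTE -> /negbTE ->].
have zAB' v : v \in A :|: B -> z v = 1 \/ z v = -1.
  by rewrite inE => /orP[/zA|/zB]; [left | right].
clearbody z.
have cases : {in E, forall e,
    [\/ wt z e = 0, wt z e = wt y e | wt z e = - wt y e]}.
  (* An edge leaving the piece has weights [y v] and [z u], both equal to 1 or -1, because [y u] and
     [z v] vanish. *)
  have half u v : u != v -> adj E u v -> u \in A :|: B -> v \notin A :|: B ->
      wt z [set u; v] = wt y [set u; v] \/ wt z [set u; v] = - wt y [set u; v].
    move=> nuv uv uAB vAB; rewrite !wt_set2 // (y0 u) // (zAB v) //.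
    have [/idPn//|nyv] := clos u v uv uAB.
    by have := sy v; case: (zAB' u uAB) => ->; lia.
  apply: edge_ind => u v nuv uv.
  have [uAB|uAB] := boolP (u \in A :|: B); last first.
    have [vAB|vAB] := boolP (v \in A :|: B); last first.
      by apply: Or31; rewrite wt_set2 // !zAB.
    rewrite setUC; have := half v u; rewrite eq_sym adj_sym.
    by case=> // ->; [apply: Or32 | apply: Or33].
  have [vAB|vAB] := boolP (v \in A :|: B); last first.
    by have [->|->] := half u v nuv uv uAB vAB; [apply: Or32 | apply: Or33].
  apply: Or31; rewrite wt_set2 //.
  move: uAB vAB; rewrite !inE => /orP[uA|uB] /orP[vA|vB].
  - by have := indA u v uA vA; rewrite uv.
  - by rewrite zA // zB.
  - by rewrite zB // zA.
  - by have := indB u v uB vB; rewrite uv.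
have sz v : -1 <= z v <= 1.
  by have [/zAB'[->|->]|/zAB ->] := boolP (v \in A :|: B).
have syz v : -1 <= y v + z v <= 1 /\ -1 <= y v + - z v <= 1.
  have := sy v; have := sz v.
  by have [/y0 ->|/zAB ->] := boolP (v \in A :|: B); lia.
have nzx : z x != 0 by case: (zAB' x xAB) => ->.
(* If no edge has opposite nonzero weights, [no_reduction] applies to [z]; if none has equal nonzero
   weights, it applies to the negative of [z]. *)
have [/existsP[e /and3P[eE nze /eqP ze]]|/existsPn no_opp] :=
  boolP [exists e, [&& e \in E, wt z e != 0 & wt z e == - wt y e]]; last first.
  apply: (no_reduction (y := y) (z := z) (x := x)) => //; try by [apply: y0].
    by move=> v; case: (syz v).
  move=> e eE; case: (cases e eE) => we; [by left | by right | left].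
  by apply/eqP/negPn/negP => nze; have := no_opp e; rewrite eE nze we eqxx.
have [/existsP[f /and3P[fE nzf /eqP zf]]|/existsPn no_same] :=
  boolP [exists e, [&& e \in E, wt z e != 0 & wt z e == wt y e]]; last first.
  apply: (no_reduction (y := y) (z := fun v => - z v) (x := x)) => //.
  - by move=> v; have := sz v; lia.
  - by move=> v; rewrite opprK; case: (syz v).
  - by rewrite oppr_eq0.
  - exact: y0.
  move=> g gE; rewrite wtN; case: (cases g gE) => wg; [left | left | right]; last 1 first.
  - by rewrite wg opprK.
  - by rewrite wg oppr0.
  apply/eqP; rewrite oppr_eq0; apply/negPn/negP => nzg.
  by have := no_same g; rewrite gE nzg wg eqxx.
(* Adding [z] makes [e] tight and subtracting it makes [f] tight, while all tight edges of [y] stay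
   tight. *)
have plus : 0 <= slack (fun v => y v + z v).
  apply: slack_lt => [v|]; first by case: (syz v).
  apply: leq_trans le_k; apply: (@loose_proper _ _ e).
  - by move=> g gE; rewrite wtD; case: (cases g gE) => ->; lia.
  - by rewrite inE eE; move: nze; rewrite ze oppr_eq0.
  - by rewrite wtD ze subrr.
have minus : 0 <= slack (fun v => y v + - z v).
  apply: slack_lt => [v|]; first by case: (syz v).
  apply: leq_trans le_k; apply: (@loose_proper _ _ f).
  - by move=> g gE; rewrite wtD wtN; case: (cases g gE) => ->; lia.
  - by rewrite inE fE -zf.
  - by rewrite wtD wtN zf subrr.
suff : slack (fun v => y v + z v) + slack (fun v => y v + - z v) =
    slack y + slack y by lia.
rewrite /slack addrACA -opprD -!big_split /= [RHS]addrACA -opprD -!big_split /=.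
congr (_ - _); last by apply: eq_bigr => v _; lia.
apply: eq_bigr => g gE; rewrite !wtD wtN.
case: (cases g gE) => ->; first by rewrite oppr0 addr0.
  by rewrite subrr upper_slope0 addr0 upper_slopeD // -expr2 sqr_ge0.
by rewrite opprK subrr upper_slope0 add0r upper_slopeD // -expr2 sqr_ge0.
Qed.

Definition positives y := [set v | y v == 1].
Definition negatives y := [set v | y v == -1].

Lemma in_support y v :
  signs y -> (v \in positives y :|: negatives y) = (y v != 0).
Proof. by move=> /(_ v); rewrite !inE; lia. Qed.

(** The colour classes of a bipartite component form a piece excluded by [no_bipartite_piece]: [y]
    vanishes on the component, and edges leaving it end in the support of [y]. *)
Lemma no_bipartite_component y :
    signs y -> (#|loose y| <= k)%N -> slack y < 0 ->
  no_bipartite_component_outside E (positives y :|: negatives y).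
Proof.
move=> sy le_k neg x xS; set S := _ :|: _ in xS *; move=> C [A [B [AB dAB bip]]].
have inC v : (v \in C) =
    (v \in ~: S) && connect (adj (induced_edges E (~: S))) x v.
  by rewrite in_set.
have AC v : v \in A -> v \in C by rewrite -AB inE => ->.
have BC v : v \in B -> v \in C by rewrite -AB inE orbC => ->.
have bipC u v : adj E u v -> u \in C -> v \in C ->
    u \in A /\ v \in B \/ u \in B /\ v \in A.
  move=> uv uC vC; have nuv := simple_adj_neq simpleE uv.
  have [|u' [v' [u'A v'B]]] := bip [set u; v].
    rewrite inE (uv : [set u; v] \in E) /=; apply/subsetP => w.
    by rewrite in_set2 => /orP[]/eqP ->.
  move/setP => eq_uv; move: (eq_uv u) (eq_uv v); rewrite !inE !eqxx ?orbT /=.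
  move=> /esym/orP[]/eqP uE /esym/orP[]/eqP vE.
  - by move: nuv; rewrite uE vE eqxx.
  - by left; rewrite uE vE.
  - by right; rewrite uE vE.
  - by move: nuv; rewrite uE vE eqxx.
apply: (@no_bipartite_piece y A B x) => //; rewrite ?AB.
- by rewrite inC in_setC xS connect0.
- by move=> v; rewrite inC in_setC in_support // negbK => /andP[/eqP].
- move=> u v uv uC.
  have [yv0|] := eqVneq (y v) 0; [left | by right].
  have vS : v \in ~: S by rewrite in_setC in_support // yv0 eqxx.
  move: uC; rewrite !inC vS => /andP[uS xu] /=.
  apply: connect_trans xu (connect1 _).
  rewrite /adj /= inE (uv : [set u; v] \in E) /=; apply/subsetP => w.
  by rewrite in_set2 => /orP[]/eqP ->.
- move=> u v uA vA; apply/negP => uv.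
  have := bipC u v uv (AC u uA) (AC v vA).
  by rewrite !(disjointFr dAB) //; case=> [[]|[]].
- move=> u v uB vB; apply/negP => uv.
  have := bipC u v uv (BC u uB) (BC v vB).
  by rewrite !(disjointFl dAB) //; case=> [[]|[]].
Qed.

(** If the restriction of [y] to [K] had negative slack, minimality would give it the same loose
    edges as [y]. The positive and negative vertices of [y] off [K] would then be a piece excluded
    by [no_bipartite_piece] for the restriction. *)
Lemma no_splitting y K x :
    signs y -> (#|loose y| <= k)%N -> x \notin K -> y x != 0 ->
    {in E, forall e, 0 <= wt (fun v => if v \in K then y v else 0) e *
                          wt (fun v => if v \in K then 0 else y v) e} ->
  0 <= slack (fun v => if v \in K then y v else 0).
Proof.
move=> sy le_k xK nyx same; rewrite leNgt; apply/negP => neg.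
set y1 := (fun v => if _ then _ else 0) in neg same *.
have s1 : signs y1 by move=> v; rewrite /y1; case: ifP.
have sub : {in E, forall e, wt y e = 0 -> wt y1 e = 0}.
  move=> e eE; have := same e eE.
  have -> : wt y e = wt y1 e + wt (fun v => if v \in K then 0 else y v) e.
    rewrite -wtD; apply: eq_bigr => v _; rewrite /y1.
    by case: ifP; rewrite ?addr0 ?add0r.
  by move: (wt y1 e) (wt _ e) => t t'; nia.
have le_k1 : (k <= #|loose y1|)%N.
  by rewrite leqNgt; apply/negP => /(slack_lt s1); rewrite leNgt neg.
have eq_l : loose y1 = loose y.
  by apply/eqP; rewrite eqEcard (loose_sub sub) (leq_trans le_k).
(* The edge is tight for [y1], hence for [y], since the loose sets agree. *)
have y10 u v : adj E u v -> y1 u = 0 -> y1 v = 0 -> y u + y v = 0.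
  move=> uv u0 v0; have nuv := simple_adj_neq simpleE uv.
  have := in_loose y uv; rewrite -eq_l in_loose // !wt_set2 // u0 v0.
  by rewrite addr0 eqxx => /esym/negbFE/eqP.
have outK v : v \notin K -> y1 v = 0 by rewrite /y1 => /negbTE ->.
apply: (@no_bipartite_piece y1 (positives y :\: K) (negatives y :\: K) x) => //.
- by rewrite -eq_l in le_k.
- by rewrite disjoints_subset; apply/subsetP => v; rewrite !inE; lia.
- by rewrite -setDUl inE xK in_support.
- by move=> v; rewrite -setDUl inE => /andP[/outK].
- move=> u v uv; rewrite -setDUl inE in_support // => /andP[uK nu].
  have [y1v|] := eqVneq (y1 v) 0; [left | by right].
  have yuv := y10 u v uv (outK u uK) y1v.
  rewrite inE in_support // andbC; apply/andP; split; first by lia.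
  by apply/negP => vK; move: y1v; rewrite /y1 vK; lia.
- move=> u v; rewrite !inE => /andP[/outK u0 /eqP yu] /andP[/outK v0 /eqP yv].
  by apply/negP => uv; have := y10 u v uv u0 v0; rewrite yu yv.
- move=> u v; rewrite !inE => /andP[/outK u0 /eqP yu] /andP[/outK v0 /eqP yv].
  by apply/negP => uv; have := y10 u v uv u0 v0; rewrite yu yv.
Qed.

(** Let [K] be the component of [x]. No edge leaving [K] joins values 1 and -1, so the parts of [y]
    on and off [K] have compatible weights and their slacks add up to that of [y]. Both are
    nonnegative by [no_splitting]. *)
Lemma connected_support y :
    signs y -> (#|loose y| <= k)%N -> slack y < 0 ->
  connected (positives y :|: negatives y)
            (edges_between E (positives y) (negatives y)).
Proof.
move=> sy le_k neg x x'; rewrite !in_support // => nx nx'.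
apply/negPn/negP => nconn.
pose K := [set v | connect (adj (edges_between E (positives y) (negatives y))) x v].
pose y1 v := if v \in K then y v else 0.
pose y2 v := if v \in K then 0 else y v.
have same : {in E, forall e, 0 <= wt y1 e * wt y2 e}.
  have half u v : adj E u v -> u \in K -> v \notin K -> 0 <= y u * y v.
    move=> uv uK vK; have := sy u; have := sy v.
    suff : ~~ ((y u == 1) && (y v == -1)) && ~~ ((y u == -1) && (y v == 1)).
      by nia.
    rewrite -negb_or; apply: contra vK => opp; rewrite inE in uK; rewrite inE.
    apply: connect_trans uK (connect1 _); rewrite /adj /= inE (uv : [set u; v] \in E) /=.
    case/orP: opp => /andP[yu yv].
      apply/existsP; exists u; rewrite inE yu; apply/existsP; exists v.
      by rewrite inE yv eqxx.
    apply/existsP; exists v; rewrite inE yv; apply/existsP; exists u.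
    by rewrite inE yu setUC eqxx.
  apply: edge_ind => u v nuv uv; rewrite !wt_set2 // /y1 /y2.
  have [uK|uK] := boolP (u \in K); have [vK|vK] := boolP (v \in K).
  - by rewrite addr0 mulr0.
  - by rewrite addr0 add0r half.
  - by rewrite addr0 add0r half // adj_sym.
  - by rewrite addr0 mul0r.
have xK : x \in K by rewrite inE connect0.
have x'K : x' \notin K by rewrite inE.
have y1_ge0 : 0 <= slack y1 by exact: (no_splitting sy le_k x'K nx' same).
have y2_ge0 : 0 <= slack y2.
  (* The functions split by [~: K] and by [K] agree only pointwise, so the equality is carried
     through the sums that define [slack]. *)
  have swap (f g : T -> int) : (fun v => if v \in ~: K then f v else g v) =1
      (fun v => if v \in K then g v else f v).
    by move=> v; rewrite inE; case: (v \in K).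
  have := @no_splitting y (~: K) x sy le_k _ nx.
  rewrite inE negbK xK => /(_ isT).
  have eq_wt f g e : wt (fun v => if v \in ~: K then f v else g v) e =
      wt (fun v => if v \in K then g v else f v) e.
    by apply: eq_bigr => v _; apply: swap.
  suff -> : slack (fun v => if v \in ~: K then y v else 0) = slack y2.
    by apply=> e eE; rewrite (eq_wt y (fun=> 0)) (eq_wt (fun=> 0) y) mulrC same.
  rewrite /slack; congr (_ - _); apply: eq_bigr => i _.
    by rewrite (eq_wt y (fun=> 0)).
  by rewrite (swap y (fun=> 0)).
suff eq_y : slack y = slack y1 + slack y2 by lia.
rewrite -slackD //.
have eq_y v : y v = y1 v + y2 v.
  by rewrite /y1 /y2; case: ifP; rewrite ?addr0 ?add0r.
rewrite /slack; congr (_ - _); apply: eq_bigr => i _; last by rewrite -eq_y.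
by congr upper_slope; apply: eq_bigr => v _; apply: eq_y.
Qed.

End Minimal.

Lemma slack_ge0 :
    (forall y, signs y ->
       connected (positives y :|: negatives y)
                 (edges_between E (positives y) (negatives y)) ->
       no_bipartite_component_outside E (positives y :|: negatives y) ->
       0 <= slack y) ->
  forall y, signs y -> 0 <= slack y.
Proof.
move=> facets y; have [k] := ubnP #|loose y|.
elim: k y => // k IHk y; rewrite ltnS => le_k sy.
rewrite leNgt; apply/negP => neg.
have IH z : signs z -> (#|loose z| < k)%N -> 0 <= slack z.
  by move=> sz lt_k; apply: IHk.
have := facets y sy (connected_support IH sy le_k neg)
  (no_bipartite_component IH sy le_k neg).
by rewrite leNgt neg.
Qed.

End Slack.

(** * Solutions *)

Section OrderedPairs.
Variable T : finType.
Implicit Types (E : {set {set T}}) (w f : T -> T -> int) (e : {set T}).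

(** Summing over all ordered pairs that span [e] avoids choosing an order of its ends; the two pairs
    are the copies of [e] in the bipartite double cover. *)
Definition both_orders w e : int :=
  \sum_(p : T * T | [set p.1; p.2] == e) w p.1 p.2.

Lemma both_orders_set2 w u v :
  u != v -> both_orders w [set u; v] = w u v + w v u.
Proof.
move=> nuv; rewrite /both_orders (bigD1 (u, v)) //= (big_pred1 (v, u)) // => -[i j].
rewrite /= !xpair_eqE; apply/andP/andP => [[/eqP eq_ij nij]|[/eqP -> /eqP ->]].
  have := set21 i j; have := set22 i j; have := set21 u v; have := set22 u v.
  rewrite -{1 2}eq_ij {3 4}eq_ij !in_set2 => vij uij.
  case/orP=> /eqP jE /orP[]/eqP iE; move: vij uij nij; rewrite iE jE ?eqxx //=.
  - by rewrite orbb eq_sym (negbTE nuv).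
  - by move=> _; rewrite orbb (negbTE nuv).
by rewrite [[set v; u]]setUC eqxx eq_sym (negbTE nuv).
Qed.

Lemma sum_both_orders E w :
  \sum_u \sum_v (if [set u; v] \in E then w u v else 0) =
  \sum_(e in E) both_orders w e.
Proof.
rewrite pair_bigA -big_mkcond /=.
rewrite (partition_big (fun p => [set p.1; p.2]) (mem E)) //=.
apply: eq_bigr => e eE; apply: eq_bigl => p.
by have [->|] := eqVneq [set p.1; p.2] e; rewrite ?andbF ?eE.
Qed.

Lemma sum_star_both_orders E f v : simple_graph E ->
    (forall i j, [set i; j] \notin E -> f i j = 0) ->
  \sum_(e in E | v \in e) both_orders f e = \sum_j f v j + \sum_i f i v.
Proof.
move=> sE f0.
(* A pair is counted once for each coordinate equal to [v], so the total of [g] splits into row [v]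
   and column [v]. *)
pose g i j := (if i == v then f i j else 0) + (if j == v then f i j else 0).
transitivity (\sum_(e in E) both_orders g e).
  rewrite big_mkcondr; apply: eq_bigr; apply: (edge_ind sE) => p q npq pq.
  rewrite !both_orders_set2 // /g !inE ![v == _]eq_sym.
  have [pv|_] := eqVneq p v; have [qv|_] := eqVneq q v => //=.
  - by move: npq; rewrite pv qv eqxx.
  - by rewrite ?addr0 ?add0r.
  - by rewrite ?addr0 ?add0r.
rewrite -sum_both_orders.
under eq_bigr => i _.
  under eq_bigr => j _.
    have -> : (if [set i; j] \in E then g i j else 0) = g i j.
      by case: ifP => // /negbT/f0 f00; rewrite /g f00 !if_same addr0.
    over.
  over.
under eq_bigr do rewrite big_split /=.
rewrite big_split /=; congr (_ + _).
  rewrite (bigD1 v) //= eqxx [X in _ + X]big1 ?addr0 // => i /negbTE ni.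
  by rewrite big1 // => j _; rewrite ni.
apply: eq_bigr => i _; rewrite (bigD1 v) //= eqxx big1 ?addr0 // => j /negbTE nj.
by rewrite nj.
Qed.

End OrderedPairs.

(** * Cuts, half-integral solutions and weak duality *)

Section Solutions.
Variables (T : finType) (E : {set {set T}}).
Variables (s : T -> int) (a b : {set T} -> int).
Hypothesis simpleE : simple_graph E.
Hypothesis le_ab : {in E, forall e : {set T}, a e <= b e}.
Implicit Types (P Q I J : {set T}) (x : {set T} -> int) (y : T -> int).

Definition diff_ind I J : T -> int := fun v => (v \in I)%:Z - (v \in J)%:Z.

Lemma signs_diff_ind I J : signs (diff_ind I J).
Proof. by move=> v; rewrite /diff_ind; case: (v \in I); case: (v \in J). Qed.

Lemma sum_diff_ind I J :
  \sum_v s v * diff_ind I J v = \sum_(i in I) s i - \sum_(j in J) s j.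
Proof.
rewrite [X in X - _]big_mkcond [X in _ - X]big_mkcond -sumrB.
apply: eq_bigr => v _; rewrite /diff_ind mulrBr; congr (_ - _).
  by case: ifP; rewrite ?mulr1 ?mulr0.
by case: ifP; rewrite ?mulr1 ?mulr0.
Qed.

(** The cut [(P, Q)] is compared with y = 1_P - 1_Q. The ordered pair (u, v) contributes
    [upper_slope] at 1_P(u) - 1_Q(v) to the cut; the two orders of an edge add up to its weight, and
    [upper_slope] is subadditive when a <= b. *)
Lemma cut_slack_ge0 :
    (forall y, signs y -> 0 <= slack E s a b y) ->
  forall P Q, 0 <= cut_slack s s
    (fun i j => if [set i; j] \in E then a [set i; j] else 0)
    (fun i j => if [set i; j] \in E then b [set i; j] else 0) P Q.
Proof.
move=> slack_ge0 P Q; apply: le_trans (slack_ge0 _ (signs_diff_ind P Q)) _.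
rewrite /slack /cut_slack sum_diff_ind.
have mk A : \sum_i s i *+ (i \in A) = \sum_(i in A) s i.
  by rewrite [RHS]big_mkcond; apply: eq_bigr => i _; case: ifP.
rewrite !mk lerD2r.
pose w i j := b [set i; j] *+ ((i \in P) && (j \notin Q))
              - a [set i; j] *+ ((i \notin P) && (j \in Q)).
have -> : \sum_i \sum_j
   ((if [set i; j] \in E then b [set i; j] else 0) *+ ((i \in P) && (j \notin Q))
  - (if [set i; j] \in E then a [set i; j] else 0) *+ ((i \notin P) && (j \in Q)))
  = \sum_(e in E) both_orders w e.
  rewrite -sum_both_orders; apply: eq_bigr => i _; apply: eq_bigr => j _.
  by case: ifP => // _; rewrite !mul0rn subr0.
apply: ler_sum; apply: (edge_ind simpleE) => u v nuv uv.
rewrite both_orders_set2 // wt_set2 // /w [[set v; u]]setUC.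
move: (le_ab uv); rewrite /diff_ind /upper_slope.
move: (a _) (b _) => {w}a0 b0.
by case: (u \in P); case: (v \in P); case: (u \in Q); case: (v \in Q);
  rewrite /= ?mulr1n ?mulr0n; lia.
Qed.

(** Bounds 0 off the edges confine the transport to [E]. Row [v] and column [v] each contribute
    [s v], whence the factor 2. *)
Lemma half_integral_solution :
    (forall y, signs y -> 0 <= slack E s a b y) ->
  exists x, {in E, forall e, 2 * a e <= x e <= 2 * b e} /\
    forall v, \sum_(e in E | v \in e) x e = 2 * s v.
Proof.
move=> /cut_slack_ge0 cuts.
have [|//|f [box rows cols]] := transportation _ _ cuts.
  by move=> i j; case: ifP => // /le_ab.
have f0 i j : [set i; j] \notin E -> f i j = 0.
  by move=> /negbTE nij; have := box i j; rewrite nij; lia.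
exists (both_orders f); split=> [|v].
  apply: (edge_ind simpleE) => u v nuv uv; rewrite both_orders_set2 //.
  have := box u v; have := box v u; rewrite [[set v; u]]setUC.
  by rewrite (uv : [set u; v] \in E); lia.
by rewrite sum_star_both_orders // rows cols; lia.
Qed.

Lemma edges_between_set2 I J u v : adj E u v ->
  ([set u; v] \in edges_between E I J) =
    (u \in I) && (v \in J) || (v \in I) && (u \in J).
Proof.
move=> uv; have nuv := simple_adj_neq simpleE uv.
rewrite inE (uv : [set u; v] \in E) /=.
apply/existsP/orP => [[i /andP[iI /existsP[j /andP[jJ /eqP/setP eq_uv]]]]|].
  have := eq_uv u; have := eq_uv v; have := eq_uv i; have := eq_uv j.
  rewrite !inE !eqxx !orbT /=.
  move=> + + /esym/orP[]/eqP vE /esym/orP[]/eqP uE.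
  - by move: nuv; rewrite uE vE eqxx.
  - by move=> _ _; right; rewrite uE vE iI.
  - by move=> _ _; left; rewrite uE vE iI.
  - by move: nuv; rewrite uE vE eqxx.
case=> /andP[uI vJ].
  by exists u; rewrite uI; apply/existsP; exists v; rewrite vJ eqxx.
by exists v; rewrite uI; apply/existsP; exists u; rewrite vJ setUC eqxx.
Qed.

Lemma sum_edges_between (w : {set T} -> int) I J :
  \sum_(e in edges_between E I J) w e =
  \sum_(e in E) (if e \in edges_between E I J then w e else 0).
Proof.
rewrite -big_mkcondr; apply: eq_bigl => e.
by rewrite andb_idl // inE => /andP[].
Qed.

(** An edge has weight 2 inside [I] and 1 from [I] to the outside, the negatives of these for [J],
    and 0 otherwise. *)
Lemma sum_upper_slope_diff_ind I J : [disjoint I & J] ->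
  \sum_(e in E) upper_slope (a e) (b e) (wt (diff_ind I J) e) =
       \sum_(e in edges_between E I (~: (I :|: J))) b e
       + 2 * (\sum_(e in edges_between E I I) b e)
       - \sum_(e in edges_between E (~: (I :|: J)) J) a e
       - 2 * (\sum_(e in edges_between E J J) a e).
Proof.
move=> dIJ; rewrite !sum_edges_between !mulr_sumr -big_split -!sumrB /=.
apply: eq_bigr; apply: (edge_ind simpleE) => u v nuv uv.
rewrite !edges_between_set2 // wt_set2 // /diff_ind /upper_slope !inE.
move: (a _) (b _) => a0 b0.
have dis w : ~~ ((w \in I) && (w \in J)).
  by apply/andP => -[wI]; rewrite (disjointFr dIJ).
move: (dis u) (dis v).
by case: (u \in I); case: (u \in J); case: (v \in I); case: (v \in J) => //= _ _;
  lia.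
Qed.

(** Weak duality: the pairing of [s] with [y] is the sum of the [x e * wt y e], each at most the
    [upper_slope] of its edge. *)
Lemma slack_ge0_of_solution x : {in E, forall e, a e <= x e <= b e} ->
    (forall v, \sum_(e in E | v \in e) x e = s v) ->
  forall y, 0 <= slack E s a b y.
Proof.
move=> box deg y; rewrite /slack subr_ge0.
have -> : \sum_v s v * y v = \sum_(e in E) x e * wt y e.
  under eq_bigr do rewrite -deg mulr_suml.
  rewrite (exchange_big_dep (mem E)) /= => [|v e _ /andP[]//].
  apply: eq_bigr => e eE; rewrite /wt mulr_sumr.
  by apply: eq_bigl => v; rewrite eE.
apply: ler_sum => e eE; have /andP[le_a le_b] := box e eE; rewrite /upper_slope.
case: ifP => [ge0|/negbT]; first exact: ler_wpM2r.
by rewrite -ltNge => /ltW le0; apply: ler_wnM2r.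
Qed.

Lemma diff_indK y : signs y -> diff_ind (positives y) (negatives y) =1 y.
Proof. by move=> sy v; have := sy v; rewrite /diff_ind !inE; lia. Qed.

End Solutions.

(** * Vector equations as degree conditions, and the equivalence *)

Lemma sum_edge_vecE (n : nat) (E : {set {set 'I_n}}) (s : 'I_n -> int)
    (x : {set 'I_n} -> int) :
  \sum_(i < n) s i *: basis_vec i = \sum_(e in E) x e *: edge_vec e <->
  forall v, \sum_(e in E | v \in e) x e = s v.
Proof.
have lhs v : (\sum_(i < n) s i *: basis_vec i) 0 v = s v.
  rewrite summxE (bigD1 v) //= !mxE !eqxx mulr1 big1 ?addr0 // => i ni.
  by rewrite !mxE eqxx (eq_sym v) (negbTE ni) mulr0.
have rhs v : (\sum_(e in E) x e *: edge_vec e) 0 v = \sum_(e in E | v \in e) x e.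
  rewrite summxE [RHS]big_mkcondr; apply: eq_bigr => e _.
  rewrite !mxE summxE; case: ifP => ve.
    rewrite (bigD1 v) //= !mxE !eqxx big1 ?addr0 ?mulr1 // => i /andP[_ ni].
    by rewrite mxE eqxx (eq_sym v) (negbTE ni).
  rewrite big1 ?mulr0 // => i ie; rewrite mxE eqxx /=.
  by case: eqP => // vi; move: ve; rewrite vi ie.
split=> [/matrixP eq_sx v|deg]; first by rewrite -rhs -eq_sx lhs.
by apply/matrixP => i v; rewrite ord1 lhs rhs.
Qed.

(** Connectedness supplies a path between edge-disjoint odd cycles, shortened to have distinct
    vertices. *)
Lemma odd_cycles_meet (T : finType) (E : {set {set T}}) (c1 c2 : seq T) :
    connected [set: T] E -> ~ has_linked_odd_cycles E ->
    odd_cycle E c1 -> odd_cycle E c2 ->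
  ~~ [disjoint cycle_edges c1 & cycle_edges c2].
Proof.
move=> connE nlink oc1 oc2; apply/negP => dis; apply: nlink.
exists c1, c2; split=> //.
have mem_head c : (2 < size c)%N -> exists x, x \in c.
  by case: c => // x c _; exists x; rewrite inE eqxx.
have [x xc1] : exists x, x \in c1 by case: oc1 => _ /mem_head.
have [z zc2] : exists z, z \in c2 by case: oc2 => _ /mem_head.
have /connectP[p xp zE] := connE x z (in_setT x) (in_setT z).
rewrite zE in zc2; case/shortenP: xp zc2 => p' xp' up' _ zc2.
by exists x, p'.
Qed.

Theorem theorem4p4 (n : nat) (E : {set {set 'I_n}})
    (simpleE : simple_graph E)
    (connE : connected [set: 'I_n] E)
    (no_linkedE : ~ has_linked_odd_cycles E)
    (nbipE : ~ bipartite [set: 'I_n] E)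
    (s : 'I_n -> int) (a b : {set 'I_n} -> int)
    (le_ab : {in E, forall e : {set 'I_n}, a e <= b e}) :
  (exists x : {set 'I_n} -> int,
     {in E, forall e : {set 'I_n}, a e <= x e <= b e} /\
     \sum_(i < n) s i *: basis_vec i = \sum_(e in E) x e *: edge_vec e)
  <->
  ((2 %| \sum_(i < n) s i)%Z /\
   forall I J : {set 'I_n},
     [disjoint I & J] ->
     connected (I :|: J) (edges_between E I J) ->
     no_bipartite_component_outside E (I :|: J) ->
     \sum_(i in I) s i - \sum_(j in J) s j <=
       \sum_(e in edges_between E I (~: (I :|: J))) b e
       + 2 * (\sum_(e in edges_between E I I) b e)
       - \sum_(e in edges_between E (~: (I :|: J)) J) a e
       - 2 * (\sum_(e in edges_between E J J) a e)).
Proof.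
split=> [[x [box /sum_edge_vecE deg]]|[ev facets]].
  (* Parity comes from the handshake identity, the inequality from weak duality at
     [diff_ind I J]. *)
  split=> [|I J dIJ _ _].
    by under eq_bigr do rewrite -deg; rewrite sum_degrees // dvdz_mulr.
  rewrite -sum_upper_slope_diff_ind // -sum_diff_ind -subr_ge0.
  exact: slack_ge0_of_solution box deg _.
(* A sign vector is the difference of the indicators of its positive and negative sets, so the
   assumed inequalities are the premise of [slack_ge0]. *)
have slack0 : forall y, signs y -> 0 <= slack E s a b y.
  apply: slack_ge0 => // y sy conn out.
  have dis : [disjoint positives y & negatives y].
    by rewrite disjoints_subset; apply/subsetP => v; rewrite !inE; lia.
  have := facets _ _ dis conn out.
  rewrite -sum_upper_slope_diff_ind // -sum_diff_ind -subr_ge0 /slack.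
  have -> : \sum_v s v * diff_ind (positives y) (negatives y) v = \sum_v s v * y v.
    by apply: eq_bigr => v _; rewrite diff_indK.
  congr (0 <= _ - _); apply: eq_bigr => e _; congr upper_slope.
  by apply: eq_bigr => v _; rewrite diff_indK.
have [x [box deg]] := half_integral_solution simpleE le_ab slack0.
have meet c1 c2 := @odd_cycles_meet _ E c1 c2 connE no_linkedE.
have [|x' [box' deg']] := halving simpleE meet _ box deg.
  by move: ev; rewrite dvdzE dvdn2.
by exists x'; split=> //; apply/sum_edge_vecE.
Qed.
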